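(* Let $n\ge m\ge 1$ be integers and $d\in\{l,r\}$. The algorithm $\mathrm{move}(n,m,d)$ described in the context performs only legal moves, transforms the initial configuration $b^nOw^m$ into the final configuration $w^mOb^n$, and uses exactly $nm+n+m$ moves; consequently it is optimal, i.e. no sequence of legal moves transforms the initial configuration into the final one with fewer moves.
   Context: The game: positions $1,\dots,n+m+1$ in a row, each holding a black checker ($b$), a white checker ($w$) or nothing, with exactly one empty position (the vacancy $O$). Initial configuration $b^nOw^m$, final configuration $w^mOb^n$. A legal move is a slide (a checker adjacent to the vacancy moves into it) or a jump (a checker at distance two from the vacancy jumps over the checker between them into it). Elementary operations: slide($l$): the checker immediately to the right of the vacancy slides left into it; slide($r$): the checker immediately to the left of the vacancy slides right into it; jump($l$): the checker two positions to the right of the vacancy jumps left into it; jump($r$): the checker two positions to the left of the vacancy jumps right into it; change($dir$) replaces $dir$ by the other element of $\{l,r\}$. The algorithm $\mathrm{move}(n,m,d)$: set $dir\gets d$. Stage 1: for $i=1,\dots,m$: perform jump($dir$) $i-1$ times, then slide($dir$), then change($dir$). Stage 2: perform jump($dir$) $m$ times. Stage 3: for $i=1,\dots,n-m$: perform slide($r$), then change($dir$), then jump($dir$) $m$ times. Stage 4: for $i=m,m-1,\dots,1$: perform change($dir$), then slide($dir$), then jump($dir$) $i-1$ times. *)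

(* Defs.v *)
From mathcomp Require Import all_boot.
Set Implicit Arguments. Unset Strict Implicit. Unset Printing Implicit Defensive.

Inductive cell := Bk | Wh | Vac.
Definition config := seq cell.

Definition is_vac (x : cell) : bool := if x is Vac then true else false.

(* Initial configuration b^n O w^m and final configuration w^m O b^n
   (positions 1..n+m+1 are the list indices 0..n+m). *)
Definition init_conf (n m : nat) : config := nseq n Bk ++ Vac :: nseq m Wh.
Definition final_conf (n m : nat) : config := nseq m Wh ++ Vac :: nseq n Bk.

Definition swap (c : config) (i j : nat) : config :=
  set_nth Vac (set_nth Vac c i (nth Vac c j)) j (nth Vac c i).

Definition legal_move (c c' : config) : Prop :=
  exists i j, [/\ i < size c /\ j < size c, nth Vac c i = Vac, nth Vac c j <> Vac,
    (j = i.+1 \/ i = j.+1 \/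
      ((j = i.+2 \/ i = j.+2) /\ nth Vac c ((i + j)./2) <> Vac)) &
    c' = swap c i j].

Fixpoint legal_run (c : config) (s : seq config) : Prop :=
  match s with
  | [::] => True
  | c' :: s' => legal_move c c' /\ legal_run c' s'
  end.

Inductive dir := L | R.
Definition change (d : dir) : dir := if d is L then R else L.

Inductive op := Slide of dir | Jump of dir.

Definition vac_pos (c : config) : nat := find is_vac c.

(* slide(l): checker right of vacancy slides left; slide(r): checker left of
   vacancy slides right; jump(l)/jump(r): checker two positions to the
   right/left of the vacancy jumps into it.  (Legality is NOT built in here;
   it is checked separately with [legal_move].) *)
Definition apply_op (o : op) (c : config) : config :=
  let v := vac_pos c in
  match o with
  | Slide L => swap c v v.+1
  | Slide R => swap c v v.-1
  | Jump L => swap c v v.+2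
  | Jump R => swap c v (v - 2)
  end.

Fixpoint trace (c : config) (os : seq op) : seq config :=
  match os with
  | [::] => [::]
  | o :: os' => let c' := apply_op o c in c' :: trace c' os'
  end.

Inductive instr := ISlideDir | IJumpDir | ISlideFix of dir | IChange.

Fixpoint compile (d : dir) (p : seq instr) : seq op :=
  match p with
  | [::] => [::]
  | ISlideDir :: p' => Slide d :: compile d p'
  | IJumpDir :: p' => Jump d :: compile d p'
  | ISlideFix e :: p' => Slide e :: compile d p'
  | IChange :: p' => compile (change d) p'
  end.

Definition move_prog (n m : nat) : seq instr :=
  flatten [seq nseq i.-1 IJumpDir ++ [:: ISlideDir; IChange] | i <- iota 1 m]
  ++ nseq m IJumpDir
  ++ flatten (nseq (n - m) (ISlideFix R :: IChange :: nseq m IJumpDir))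
  ++ flatten [seq IChange :: ISlideDir :: nseq i.-1 IJumpDir | i <- rev (iota 1 m)].

Definition move_ops (n m : nat) (d : dir) : seq op := compile d (move_prog n m).

(* Main.v *)
Require Import Defs.
From mathcomp Require Import all_boot.
From mathcomp Require Import zify.

(** Correctness: every stage acts on words that are alternating around the
    vacancy, and a run of jumps carries the vacancy across such a block,
    turning (bw)^i into (wb)^i.

    Optimality: let u be the word of checkers without the vacancy, and g the
    number of checkers to the left of the vacancy. Only a jump over a checker of
    the other colour changes u, by an adjacent transposition, so it creates at
    most one inversion (a white to the left of a black), and nm inversions are
    needed. The slides are counted separately. The leading run of u runs
    through b^n, ..., b^1, w^1, ..., w^m, a path with n+m vertices; a jump
    traverses consecutive edges of this path at gaps g of opposite parities, and
    only slides change the parity of g. This forces n+m-1 slides up to the last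
    edge, counting the one before the first edge, and one more at the end.
    Inversions and forced slides add up to a potential that no move raises by
    more than 1. *)

Set Implicit Arguments.
Unset Strict Implicit.
Unset Printing Implicit Defensive.

(** * Configurations split at the vacancy *)

Definition checker (b : bool) : cell := if b then Bk else Wh.

Definition conf (p q : seq bool) : config :=
  map checker p ++ Vac :: map checker q.

Lemma checker_neq_Vac b : checker b <> Vac.
Proof. by case: b. Qed.

Lemma size_conf p q : size (conf p q) = size p + (size q).+1.
Proof. by rewrite size_cat /= !size_map. Qed.

Lemma vac_pos_conf p q : vac_pos (conf p q) = size p.
Proof. by elim: p => //= -[] p IHp; rewrite /vac_pos /= -IHp. Qed.

Lemma nth_conf_size p q : nth Vac (conf p q) (size p) = Vac.
Proof. by rewrite nth_cat size_map ltnn subnn. Qed.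

Lemma nth_conf_Vac p q i :
  i < size (conf p q) -> nth Vac (conf p q) i = Vac -> i = size p.
Proof.
rewrite size_conf nth_cat size_map => lti.
case: ltnP => [ltip|leip].
  by rewrite (nth_map true) // => /checker_neq_Vac.
case: (posnP (i - size p)) => [|gti]; first by lia.
rewrite -(prednK gti) /= (nth_map true) => [/checker_neq_Vac //|]; lia.
Qed.

(** * Exchanging two cells of a word *)

Lemma set_nth_cat_size (T : Type) (x0 x y : T) s t :
  set_nth x0 (s ++ x :: t) (size s) y = s ++ y :: t.
Proof. by elim: s => //= z s ->. Qed.

Lemma nth_cat_size (T : Type) (x0 x : T) s t :
  nth x0 (s ++ x :: t) (size s) = x.
Proof. by rewrite nth_cat ltnn subnn. Qed.

(** Here [t] is the stretch between the two exchanged cells: empty for a slide, one checker for a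
    jump. One statement thus serves both kinds of move. *)
Lemma swap_cat x y s t u :
  swap (s ++ x :: t ++ y :: u) (size s) (size s + (size t).+1) =
  s ++ y :: t ++ x :: u.
Proof.
have E z v : s ++ z :: t ++ v = (s ++ z :: t) ++ v by rewrite -catA.
have S z : size s + (size t).+1 = size (s ++ z :: t) by rewrite size_cat.
rewrite /swap nth_cat_size [in nth _ _ (_ + _)]E (S x) nth_cat_size.
by rewrite set_nth_cat_size -(S x) (S y) E set_nth_cat_size -catA.
Qed.

Lemma swap_cat_sym x y s t u :
  swap (s ++ x :: t ++ y :: u) (size s + (size t).+1) (size s) =
  s ++ y :: t ++ x :: u.
Proof.
have E z v : s ++ z :: t ++ v = (s ++ z :: t) ++ v by rewrite -catA.
have S z : size s + (size t).+1 = size (s ++ z :: t) by rewrite size_cat.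
rewrite /swap nth_cat_size [in nth _ _ (_ + _)]E (S x) nth_cat_size.
by rewrite E set_nth_cat_size -catA set_nth_cat_size.
Qed.

Lemma swap_slideL p a q :
  swap (conf p (a :: q)) (size p) (size p).+1 = conf (rcons p a) q.
Proof.
have := swap_cat Vac (checker a) (map checker p) [::] (map checker q).
by rewrite size_map addn1 /conf map_rcons cat_rcons.
Qed.

Lemma swap_slideR p a q :
  swap (conf (rcons p a) q) (size p).+1 (size p) = conf p (a :: q).
Proof.
have := swap_cat_sym (checker a) Vac (map checker p) [::] (map checker q).
by rewrite size_map addn1 /conf map_rcons cat_rcons.
Qed.

Lemma swap_jumpL p a b q :
  swap (conf p [:: a, b & q]) (size p) (size p).+2 = conf (p ++ [:: b; a]) q.
Proof.
have := swap_cat Vac (checker b) (map checker p) [:: checker a] (map checker q).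
by rewrite size_map addn2 /conf map_cat -catA.
Qed.

Lemma swap_jumpR p a b q :
  swap (conf (p ++ [:: a; b]) q) (size p).+2 (size p) = conf p [:: b, a & q].
Proof.
have := swap_cat_sym (checker a) Vac (map checker p) [:: checker b] (map checker q).
by rewrite size_map addn2 /conf map_cat -catA.
Qed.

(** * Legal moves in terms of the two sides of the vacancy *)

Lemma legal_slideL p a q : legal_move (conf p (a :: q)) (conf (rcons p a) q).
Proof.
exists (size p), (size p).+1; split; last by rewrite swap_slideL.
- by rewrite size_conf /=; lia.
- exact: nth_conf_size.
- rewrite nth_cat size_map ltnNge leqnSn subSn // subnn /=.
  exact: checker_neq_Vac.
- by left.
Qed.

Lemma legal_slideR p a q : legal_move (conf (rcons p a) q) (conf p (a :: q)).
Proof.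
exists (size p).+1, (size p); split; last by rewrite swap_slideR.
- by rewrite size_conf size_rcons /=; lia.
- by rewrite -(size_rcons p a) nth_conf_size.
- rewrite /conf map_rcons cat_rcons nth_cat size_map ltnn subnn.
  exact: checker_neq_Vac.
- by right; left.
Qed.

Lemma legal_jumpL p a b q :
  legal_move (conf p [:: a, b & q]) (conf (p ++ [:: b; a]) q).
Proof.
exists (size p), (size p).+2; split; last by rewrite swap_jumpL.
- by rewrite size_conf /=; lia.
- exact: nth_conf_size.
- rewrite nth_cat size_map ifF; last by lia.
  rewrite (_ : _ - _ = 2) /=; last by lia.
  exact: checker_neq_Vac.
- right; right; split; first by left.
  rewrite (_ : _./2 = (size p).+1); last by lia.
  rewrite nth_cat size_map ifF; last by lia.
  rewrite (_ : _ - _ = 1) /=; last by lia.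
  exact: checker_neq_Vac.
Qed.

Lemma legal_jumpR p a b q :
  legal_move (conf (p ++ [:: a; b]) q) (conf p [:: b, a & q]).
Proof.
exists (size p).+2, (size p); split; last by rewrite swap_jumpR.
- by rewrite size_conf size_cat /=; lia.
- by rewrite -(addn2 (size p)) -(size_cat p [:: a; b]) nth_conf_size.
- rewrite /conf map_cat -catA nth_cat size_map ltnn subnn.
  exact: checker_neq_Vac.
- right; right; split; first by right.
  rewrite (_ : _./2 = (size p).+1); last by lia.
  rewrite /conf map_cat -catA nth_cat size_map ifF; last by lia.
  rewrite (_ : _ - _ = 1) /=; last by lia.
  exact: checker_neq_Vac.
Qed.

Variant step_spec (p q : seq bool) : config -> Prop :=
| StepSlideL a q' of q = a :: q' : step_spec p q (conf (rcons p a) q')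
| StepSlideR a p' of p = rcons p' a : step_spec p q (conf p' (a :: q))
| StepJumpL a b q' of q = [:: a, b & q'] :
    step_spec p q (conf (p ++ [:: b; a]) q')
| StepJumpR a b p' of p = p' ++ [:: a; b] :
    step_spec p q (conf p' [:: b, a & q]).

(** The vacancy is unique, so [i] must be [size p]; the four admissible places of [j] relative to it
    give the four cases. *)
Lemma legal_moveP p q c : legal_move (conf p q) c -> step_spec p q c.
Proof.
case=> i [j [[lti ltj] ci _ adj ->]].
have Ei := nth_conf_Vac lti ci; subst i.
move: ltj; rewrite size_conf => ltj {lti ci}.
case: adj => [Ej|[Ej|[[Ej|Ej] _]]].
- subst j; case: q ltj => [|a q] /= ltj; first by lia.
  by rewrite swap_slideL; apply: StepSlideL.
- case: (lastP p) Ej => // {ltj}p a; rewrite size_rcons => -[<-].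
  by rewrite swap_slideR; apply: StepSlideR.
- subst j; case: q ltj => [|a [|b q]] /= ltj; try by lia.
  by rewrite swap_jumpL; apply: StepJumpL.
- case: (lastP p) Ej => // {ltj}p b.
  case: (lastP p) => // {}p a; rewrite !size_rcons => -[<-].
  rewrite -!cats1 -catA swap_jumpR; exact: StepJumpR.
Qed.

(** * Correctness of the algorithm *)

Definition reach (c : config) (os : seq op) (c' : config) : Prop :=
  legal_run c (trace c os) /\ last c (trace c os) = c'.

Lemma reach_cons c o os c' :
  legal_move c (apply_op o c) -> reach (apply_op o c) os c' ->
  reach c (o :: os) c'.
Proof. by move=> cc' []. Qed.

Lemma reach_cat c os c' os' c'' :
  reach c os c' -> reach c' os' c'' -> reach c (os ++ os') c''.
Proof.
elim: os c => [|o os IHos] c [] /=; first by move=> _ ->.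
by move=> [cc' run] lst run'; apply: reach_cons => //; apply: IHos.
Qed.

Lemma apply_slideL p a q :
  apply_op (Slide L) (conf p (a :: q)) = conf (rcons p a) q.
Proof. by rewrite /apply_op vac_pos_conf swap_slideL. Qed.

Lemma apply_slideR p a q :
  apply_op (Slide R) (conf (rcons p a) q) = conf p (a :: q).
Proof. by rewrite /apply_op vac_pos_conf size_rcons swap_slideR. Qed.

Lemma apply_jumpL p a b q :
  apply_op (Jump L) (conf p [:: a, b & q]) = conf (p ++ [:: b; a]) q.
Proof. by rewrite /apply_op vac_pos_conf swap_jumpL. Qed.

Lemma apply_jumpR p a b q :
  apply_op (Jump R) (conf (p ++ [:: a; b]) q) = conf p [:: b, a & q].
Proof.
by rewrite /apply_op vac_pos_conf size_cat addnK addn2 swap_jumpR.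
Qed.

Lemma reach_slideL p a q os c :
  reach (conf (rcons p a) q) os c -> reach (conf p (a :: q)) (Slide L :: os) c.
Proof.
by move=> H; apply: reach_cons; rewrite apply_slideL //; apply: legal_slideL.
Qed.

Lemma reach_slideR p a q os c :
  reach (conf p (a :: q)) os c -> reach (conf (rcons p a) q) (Slide R :: os) c.
Proof.
by move=> H; apply: reach_cons; rewrite apply_slideR //; apply: legal_slideR.
Qed.

(** * Jumps across alternating blocks *)

Definition alt (a b : bool) (i : nat) : seq bool := flatten (nseq i [:: a; b]).

Lemma altSr a b i : alt a b i.+1 = alt a b i ++ [:: a; b].
Proof. by rewrite /alt -addn1 nseqD flatten_cat. Qed.

(** The identity $a(ba)^i = (ab)^i a$ regroups the block after a slide, shifting it by one
    checker. *)
Lemma cons_alt a b i : a :: alt b a i = rcons (alt a b i) a.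
Proof. by elim: i => //= i <-. Qed.

Lemma reach_jumpsL a b i p q :
  reach (conf p (alt a b i ++ q)) (nseq i (Jump L)) (conf (p ++ alt b a i) q).
Proof.
elim: i p => [|i IHi] p /=; first by rewrite cats0.
apply: reach_cons; rewrite apply_jumpL; first exact: legal_jumpL.
by have := IHi (p ++ [:: b; a]); rewrite -catA.
Qed.

Lemma reach_jumpsR a b i p q :
  reach (conf (p ++ alt a b i) q) (nseq i (Jump R)) (conf p (alt b a i ++ q)).
Proof.
elim: i q => [|i IHi] q /=; first by rewrite cats0.
rewrite altSr catA; apply: reach_cons; rewrite apply_jumpR.
  exact: legal_jumpR.
have := IHi [:: b, a & q].
by rewrite -[[:: b, a & q]]/([:: b; a] ++ q) catA -altSr.
Qed.

Definition dir_after (d : dir) (p : seq instr) : dir :=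
  foldl (fun d x => if x is IChange then change d else d) d p.

Lemma dir_after_cat d p p' :
  dir_after d (p ++ p') = dir_after (dir_after d p) p'.
Proof. exact: foldl_cat. Qed.

Lemma compile_cat d p p' :
  compile d (p ++ p') = compile d p ++ compile (dir_after d p) p'.
Proof. by elim: p d => [|[|| e|] p IHp] d //=; rewrite IHp. Qed.

Lemma compile_jumps d i : compile d (nseq i IJumpDir) = nseq i (Jump d).
Proof. by elim: i => //= i ->. Qed.

Lemma dir_after_jumps d i : dir_after d (nseq i IJumpDir) = d.
Proof. by elim: i. Qed.

(** The final value of dir is recorded next to the final configuration, because the compilation of
    what follows depends on it; this makes the stages composable. *)
Definition exec (d : dir) (c : config) (p : seq instr) (d' : dir)
    (c' : config) : Prop :=
  reach c (compile d p) c' /\ dir_after d p = d'.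

Lemma exec_cat d c p d' c' p' d'' c'' :
  exec d c p d' c' -> exec d' c' p' d'' c'' -> exec d c (p ++ p') d'' c''.
Proof.
move=> [cc' <-] [c'c'' <-]; split; last by rewrite dir_after_cat.
by rewrite compile_cat; apply: reach_cat cc' c'c''.
Qed.

Lemma exec_nil d c : exec d c [::] d c.
Proof. by []. Qed.

(* The vacancy sits at the end of the middle block [s] from which a sequence of
   jumps in direction [d] crosses it. *)
Definition before_block (d : dir) (p s q : seq bool) : config :=
  if d is L then conf p (s ++ q) else conf (p ++ s) q.

(** Having crossed the block, the vacancy stands where jumps in the opposite direction would
    start. *)
Definition after_block (d : dir) := before_block (change d).

Lemma reach_jumps d a b i p q :
  reach (before_block d p (alt a b i) q) (nseq i (Jump d))
        (after_block d p (alt b a i) q).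
Proof. by case: d; [apply: reach_jumpsL|apply: reach_jumpsR]. Qed.

(** * The four stages *)

Lemma nseqSr (T : Type) k (x : T) : nseq k.+1 x = rcons (nseq k x) x.
Proof. by elim: k => //= k <-. Qed.

(** The jumps turn $(bw)^i$ into $(wb)^i$. The slide passes the vacancy over one neighbouring
    checker, and the block absorbs the $b$ on its left and the $w$ on its right: $b(wb)^iw =
    (bw)^{i+1}$. *)
Lemma stage1_step d i k l :
  exec d
    (before_block d (nseq k.+1 true) (alt true false i) (nseq l.+1 false))
    (nseq i IJumpDir ++ [:: ISlideDir; IChange])
    (change d)
    (before_block (change d)
       (nseq k true) (alt true false i.+1) (nseq l false)).
Proof.
split; last by rewrite dir_after_cat dir_after_jumps.
rewrite compile_cat compile_jumps dir_after_jumps.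
apply: reach_cat; first exact: reach_jumps.
rewrite nseqSr; case: d => /=.
  apply: reach_slideL; split=> //=; congr conf.
  by rewrite cat_rcons rcons_cat /= -cons_alt.
apply: reach_slideR; split=> //=; congr conf.
by rewrite -cat_rcons -cons_alt.
Qed.

(** Here [i] rounds are done and [j] remain. The final direction depends on the parity of [j]; it
    can stay existential since the later stages work from either direction. *)
Lemma stage1_exec d i j k :
  exists d', exec d
    (before_block d (nseq (j + k) true) (alt true false i) (nseq j false))
    (flatten [seq nseq x.-1 IJumpDir ++ [:: ISlideDir; IChange]
             | x <- iota i.+1 j])
    d' (before_block d' (nseq k true) (alt true false (i + j)) [::]).
Proof.
elim: j i d => [|j IHj] i d /=.
  by exists d; rewrite addn0; apply: exec_nil.
have [d' Hd'] := IHj i.+1 (change d).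
exists d'; rewrite -addSnnS.
apply: exec_cat Hd'; exact: stage1_step.
Qed.

Lemma stage2_exec d m k :
  exec d (before_block d (nseq k true) (alt true false m) [::])
    (nseq m IJumpDir) d
    (after_block d (nseq k true) (alt false true m) [::]).
Proof.
split; last exact: dir_after_jumps.
by rewrite compile_jumps; apply: reach_jumps.
Qed.

(** On either side of the block the checker to the left of the vacancy is black, so slide($r$)
    always carries a black to the right. As $b(wb)^m = (bw)^m b$, this leaves a block $(bw)^m$ one
    place further left, which the jumps turn back into $(wb)^m$. *)
Lemma stage3_step d m k l :
  exec d (after_block d (nseq k.+1 true) (alt false true m) (nseq l true))
    (ISlideFix R :: IChange :: nseq m IJumpDir) (change d)
    (after_block (change d) (nseq k true) (alt false true m) (nseq l.+1 true)).
Proof.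
rewrite [nseq k.+1 _]nseqSr; split=> /=; last exact: dir_after_jumps.
rewrite compile_jumps /after_block; case: d => /=.
  rewrite cat_rcons cons_alt -rcons_cat; apply: reach_slideR.
  exact: (reach_jumps R).
apply: reach_slideR; rewrite -cat_cons cons_alt cat_rcons.
exact: (reach_jumps L).
Qed.

Lemma stage3_exec d m k l :
  exists d',
  exec d (after_block d (nseq k true) (alt false true m) (nseq l true))
    (flatten (nseq k (ISlideFix R :: IChange :: nseq m IJumpDir))) d'
    (after_block d' [::] (alt false true m) (nseq (k + l) true)).
Proof.
elim: k l d => [|k IHk] l d; first by exists d; apply: exec_nil.
have [d' Hd'] := IHk l.+1 (change d).
exists d'; rewrite addSnnS.
apply: exec_cat Hd'; exact: stage3_step.
Qed.

(** This undoes the growth of the first stage: $(wb)^{i+1} = w(bw)^i b$ releases its outer checkers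
    to the two sides, and the jumps turn the remaining $(bw)^i$ into $(wb)^i$. *)
Lemma stage4_step d i k l :
  exec d (after_block d (nseq k false) (alt false true i.+1) (nseq l true))
    (IChange :: ISlideDir :: nseq i IJumpDir) (change d)
    (after_block (change d)
       (nseq k.+1 false) (alt false true i) (nseq l.+1 true)).
Proof.
split=> /=; last exact: dir_after_jumps.
rewrite compile_jumps /after_block; case: d.
  rewrite altSr /= -[[:: false; true]]/(rcons [:: false] true) -rcons_cat.
  rewrite -rcons_cat; apply: reach_slideR.
  rewrite cats1 -cons_alt -(cat_rcons false) -nseqSr.
  exact: (reach_jumps R true false i (nseq k.+1 false)).
apply: reach_slideL; rewrite -nseqSr -cat_cons cons_alt cat_rcons.
exact: (reach_jumps L true false i (nseq k.+1 false)).
Qed.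

Lemma rev_iotaS i : rev (iota 1 i.+1) = i.+1 :: rev (iota 1 i).
Proof. by rewrite -(addn1 i) iotaD rev_cat add1n addn1. Qed.

Lemma stage4_exec d i k l :
  exists d',
  exec d (after_block d (nseq k false) (alt false true i) (nseq l true))
    (flatten [seq IChange :: ISlideDir :: nseq x.-1 IJumpDir
             | x <- rev (iota 1 i)]) d'
    (conf (nseq (i + k) false) (nseq (i + l) true)).
Proof.
elim: i k l d => [|i IHi] k l d.
  exists d; rewrite /after_block; case: d => /=; rewrite ?cats0; exact: exec_nil.
have [d' Hd'] := IHi k.+1 l.+1 (change d).
exists d'; rewrite !addSnnS rev_iotaS.
apply: exec_cat Hd'; exact: stage4_step.
Qed.

Lemma init_confE n m : init_conf n m = conf (nseq n true) (nseq m false).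
Proof. by rewrite /conf !map_nseq. Qed.

Lemma final_confE n m : final_conf n m = conf (nseq m false) (nseq n true).
Proof. by rewrite /conf !map_nseq. Qed.

Lemma move_reach n m d :
  m <= n -> reach (init_conf n m) (move_ops n m d) (final_conf n m).
Proof.
move=> lemn.
have [d1 H1] := stage1_exec d 0 m (n - m).
have H2 := stage2_exec d1 m (n - m).
have [d3 H3] := stage3_exec d1 m (n - m) 0.
have [d4 H4] := stage4_exec d3 m 0 (n - m).
rewrite init_confE final_confE.
rewrite addn0 in H3; rewrite addn0 in H4; rewrite subnKC // in H1 H4.
have [] := exec_cat H1 (exec_cat H2 (exec_cat H3 H4)).
(* The first block is empty, so its two ends coincide and the initial configuration suits both
   directions. *)
by case: {H1} d => /=; rewrite ?cats0.
Qed.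

(** * The number of moves *)

Definition cost (p : seq instr) : nat :=
  count (fun x => if x is IChange then false else true) p.

Lemma size_compile d p : size (compile d p) = cost p.
Proof. by elim: p d => [|[|| e|] p IHp] d //=; rewrite IHp. Qed.

Lemma cost_cat p p' : cost (p ++ p') = cost p + cost p'.
Proof. exact: count_cat. Qed.

Lemma cost_jumps i : cost (nseq i IJumpDir) = i.
Proof. by rewrite /cost count_nseq mul1n. Qed.

Lemma size_move_ops n m d : m <= n -> size (move_ops n m d) = n * m + n + m.
Proof.
move=> lemn; rewrite size_compile /move_prog !cost_cat cost_jumps.
set s1 := flatten _; set s3 := flatten _; set s4 := flatten _.
(* Round $i$ of the first and of the last stage costs $i$ moves; the triangular sums are doubled to
   avoid division. *)
have E1 : (cost s1).*2 = m * m.+1.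
  rewrite /s1 {s1 s3 s4 lemn}; elim: m => // m IHm.
  rewrite -[in iota 1 _](addn1 m) iotaD map_cat flatten_cat cost_cat add1n /=.
  by rewrite cats0 cost_cat cost_jumps /=; lia.
have E4 : (cost s4).*2 = m * m.+1.
  rewrite /s4 {E1 s1 s3 s4 lemn}; elim: m => // m IHm.
  by rewrite rev_iotaS /= add0n cost_cat cost_jumps; lia.
have E3 : cost s3 = (n - m) * m.+1.
  rewrite /s3; elim: (n - m) => // k IHk.
  by rewrite /= add0n cost_cat cost_jumps; lia.
rewrite E3; nia.
Qed.

(** * Optimality *)

Fixpoint inversions (u : seq bool) : nat :=
  if u is x :: u' then (if x then 0 else count id u') + inversions u' else 0.

Definition lead_run (u : seq bool) : nat := find (predC1 (head true u)) u.

(* Index of the leading run in b^n, ..., b^1, w^1, ..., w^m, plus a parity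
   correction that is invariant under jumps. *)
Definition slide_potential (n g : nat) (u : seq bool) : nat :=
  if head true u then n - lead_run u + odd (g + lead_run u)
  else n + (lead_run u).-1 + odd (g + (lead_run u).+1).

Definition potential (n : nat) (p q : seq bool) : nat :=
  inversions (p ++ q) + slide_potential n (size p) (p ++ q).

(** * Effect of one move on the potential *)

Lemma inversions_transpose p a b q :
  inversions (p ++ [:: b, a & q]) <= (inversions (p ++ [:: a, b & q])).+1.
Proof.
elim: p => [|x p IHp] /=; first by case: a; case: b => /=; lia.
have -> : count id (p ++ [:: b, a & q]) = count id (p ++ [:: a, b & q]).
  by rewrite !count_cat /=; lia.
by case: x; lia.
Qed.

Lemma slide_potential_parity n g g' u :
  odd g = odd g' -> slide_potential n g u = slide_potential n g' u.
Proof. by rewrite /slide_potential !oddD => ->. Qed.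

(** The gap enters only through a parity bit. *)
Lemma slide_potential_lip n g g' u :
  slide_potential n g u <= (slide_potential n g' u).+1.
Proof. by rewrite /slide_potential; case: ifP => _; lia. Qed.

(** If the transposition changes the leading run, it moves the run along one edge of the path, and
    the parity of [size p] makes the correction 1 at the lower end and 0 at the upper end. Taking
    the number of blacks for $n$ keeps the subtraction $n - r$ exact for a black run of length
    $r$. *)
Lemma slide_potential_transpose p a b q :
  slide_potential (count id (p ++ [:: a, b & q])) (size p) (p ++ [:: b, a & q])
  = slide_potential (count id (p ++ [:: a, b & q])) (size p)
      (p ++ [:: a, b & q]).
Proof.
rewrite /slide_potential /lead_run.
case: p => [|x p].
  by case: a; case: b => //=; lia.
rewrite [head _ _]/= [X in find (predC1 X)]/= [head true ((x :: p) ++ _)]/=.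
(* If the run ends inside the prefix, the transposition does not affect it; otherwise the prefix is
   constant. *)
rewrite !find_cat; case: (boolP (has _ (x :: p))) => // hasp.
have allp : all (pred1 x) (x :: p) by rewrite -[all _ _]negbK -has_predC.
have cntp : x -> count id (x :: p) = size (x :: p).
  move=> xt; apply/eqP; rewrite -all_count.
  by apply: sub_all allp => y /eqP ->.
rewrite count_cat; move: (count id (x :: p)) cntp => c cntp.
case: x cntp {hasp allp} => /= [/(_ isT) ->|_];
  by case: a; case: b => //=; lia.
Qed.

Lemma potential_step n p q c :
  count id (p ++ q) = n -> legal_move (conf p q) c ->
  exists p' q', [/\ c = conf p' q', count id (p' ++ q') = n
    & potential n p' q' <= (potential n p q).+1].
Proof.
move=> cnt /legal_moveP[a q' Eq|a p' Ep|a b q' Eq|a b p' Ep]; subst.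
- exists (rcons p a), q'; split=> //; rewrite /potential cat_rcons //.
  rewrite -addnS leq_add2l; exact: slide_potential_lip.
- exists p', (a :: q); split=> //; rewrite /potential cat_rcons //.
  rewrite -addnS leq_add2l; exact: slide_potential_lip.
- exists (p ++ [:: b; a]), q'; rewrite /potential -catA /=.
  split=> //; first by rewrite !count_cat /=; lia.
  rewrite -addSn leq_add ?inversions_transpose //.
  (* A jump changes the gap by two, so both sides may be evaluated at the same gap. *)
  rewrite (@slide_potential_parity _ _ (size p)); last first.
    by rewrite size_cat /=; lia.
  by rewrite slide_potential_transpose.
- exists p', [:: b, a & q]; rewrite /potential -!catA /=.
  split=> //; first by rewrite !count_cat /=; lia.
  rewrite -addSn leq_add ?inversions_transpose //.
  rewrite slide_potential_transpose.
  rewrite (@slide_potential_parity _ (size (p' ++ _)) (size p')) //.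
  by rewrite size_cat /=; lia.
Qed.

Lemma conf_inj p q p' q' : conf p q = conf p' q' -> p = p' /\ q = q'.
Proof.
have chK : cancel checker (fun x => if x is Bk then true else false) by case.
have chI := inj_map (can_inj chK).
rewrite /conf; elim: p p' => [|x p IHp] [|x' p'] /=.
- by case=> /chI.
- by case: x'.
- by case: x.
- by case=> /(can_inj chK) <- /IHp[-> ->].
Qed.

Lemma potential_run n s p q p' q' :
  count id (p ++ q) = n ->
  legal_run (conf p q) s -> last (conf p q) s = conf p' q' ->
  potential n p' q' <= potential n p q + size s.
Proof.
elim: s p q => [|c s IHs] p q cnt /=.
  by move=> _ /conf_inj[<- <-]; rewrite addn0.
case=> /(potential_step cnt)[p1 [q1 [-> cnt1 le1]]] run lst.
by rewrite addnS -addSn (leq_trans (IHs _ _ cnt1 run lst)) // leq_add2r.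
Qed.

(** * The potential at the two end configurations *)

Lemma find_run x i j :
  find (predC1 x) (nseq i x ++ nseq j (~~ x)) = i.
Proof. by elim: i => [|i IHi] /=; [case: j; case: x|rewrite eqxx IHi]. Qed.

Lemma potential_init n m :
  0 < n -> potential n (nseq n true) (nseq m false) = 0.
Proof.
move=> n_gt0; rewrite /potential /slide_potential /lead_run.
have -> : head true (nseq n true ++ nseq m false) = true by case: n n_gt0.
rewrite (find_run true) size_nseq subnn addnn odd_double !addn0.
elim: n {n_gt0} => //=; elim: m => //= m ->.
by rewrite count_nseq.
Qed.

Lemma potential_final n m :
  0 < m -> potential n (nseq m false) (nseq n true) = n * m + n + m.
Proof.
move=> m_gt0; rewrite /potential /slide_potential /lead_run.
have -> : head true (nseq m false ++ nseq n true) = false by case: m m_gt0.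
rewrite (find_run false) size_nseq.
have -> : inversions (nseq m false ++ nseq n true) = n * m.
  elim: m {m_gt0} => [|m IHm] /=; first by rewrite muln0; elim: n.
  by rewrite IHm count_cat !count_nseq mulnS /=; lia.
(* Run length and gap are both $m$, so the correction is [odd (m + m.+1)], that is 1: the final
   slide, which brings $n + (m-1)$ up to $n + m$. *)
lia.
Qed.

Lemma run_lower_bound n m s :
  0 < m -> 0 < n ->
  legal_run (init_conf n m) s -> last (init_conf n m) s = final_conf n m ->
  n * m + n + m <= size s.
Proof.
move=> m_gt0 n_gt0; rewrite init_confE final_confE => run lst.
rewrite -potential_final // -[size s]add0n -(potential_init m n_gt0).
by apply: potential_run run lst; rewrite count_cat !count_nseq /=; lia.
Qed.

Theorem theorem2 (n m : nat) (d : dir) :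
  1 <= m -> m <= n ->
  [/\ legal_run (init_conf n m) (trace (init_conf n m) (move_ops n m d)),
      last (init_conf n m) (trace (init_conf n m) (move_ops n m d)) = final_conf n m,
      size (move_ops n m d) = n * m + n + m
    & forall s : seq config,
        legal_run (init_conf n m) s -> last (init_conf n m) s = final_conf n m ->
        n * m + n + m <= size s].
Proof.
move=> m_gt0 lemn; have [run lst] := move_reach d lemn.
split=> //; first exact: size_move_ops.
by move=> s; apply: run_lower_bound => //; apply: leq_trans lemn.
Qed.
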